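(* Let $I=(U,R)$ be an approximation space and let $(T,\Delta,\nabla)$ be its rough semiring. For $RS(X)\in T$, the pseudocomplement of $RS(X)$ is unique.
   Context: Setting. $I=(U,R)$ is an approximation space: $U$ is a non-empty finite set, $R$ an arbitrary equivalence relation on $U$, and $[x]_R$ is the class of $x$. For $X\subseteq U$ put $R_{-}(X)=\{x\in U: [x]_R\subseteq X\}$, $R^{-}(X)=\{x\in U: [x]_R\cap X\neq\emptyset\}$. The rough set of $X$ is $RS(X)=(R_{-}(X),R^{-}(X))$, and $T=\{RS(X): X\subseteq U\}$. $T$ is ordered componentwise: $RS(X)\le RS(Y)$ iff $R_{-}(X)\subseteq R_{-}(Y)$ and $R^{-}(X)\subseteq R^{-}(Y)$. Operations on subsets of $U$. Let $IW(X)$ be the number of equivalence classes contained in $X$. Praba join: if $IW(X\cup Y)=IW(X)+IW(Y)-IW(X\cap Y)$ then $X\Delta Y=X\cup Y$. If $IW(X\cup Y)>IW(X)+IW(Y)-IW(X\cap Y)$, one identifies an equivalence class newly formed by the union (contained in $X\cup Y$ but in neither $X$ nor $Y$), deletes from $Y$ its elements belonging to that class, calls the result $Y$ again, and repeats until equality holds; then $X\Delta Y$ is the union of $X$ and the final $Y$. Praba meet: $x$ is a pivot element of $X,Y$ if $[x]_R\not\subseteq X\cap Y$, $[x]_R\cap X\ne\emptyset$ and $[x]_R\cap Y\neq\emptyset$; the pivot set $P_{X\cap Y}$ is the set of pivot elements, each pivot element in it being taken as the representative of its class; $X\nabla Y=\{x\in U:[x]_R\subseteq X\cap Y\}\cup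 P_{X\cap Y}$. Operations on $T$. $RS(X)\Delta RS(Y)=RS(X\Delta Y)$ and $RS(X)\nabla RS(Y)=RS(X\nabla Y)$; it is known that these are respectively the least upper bound and the greatest lower bound of $RS(X),RS(Y)$ in $T$, and that $(T,\Delta,\nabla)$ is a semiring, called the rough semiring. Definition. An element $RS(X)\in T$ is said to have a pseudocomplement if there exists a greatest element $RS(X)^{*}\in T$ disjoint from $RS(X)$, that is, with $RS(X)\nabla RS(X)^{*}=RS(X\nabla X^{*})=RS(\emptyset)$ (where $X^{*}\subseteq U$ is such that $RS(X^{*})=RS(X)^{*}$). The pseudocomplement is $RS(X)^{*}=\max\{RS(Y)\in T: RS(X)\nabla RS(Y)=RS(X\nabla Y)=RS(\emptyset)\}$. *)

(* Defs.v *)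
From HB Require Import structures.
From mathcomp Require Import all_boot all_order all_algebra.

Set Implicit Arguments.
Unset Strict Implicit.
Unset Printing Implicit Defensive.

Record approx_space := ApproxSpace {
  universe :> finType;
  indisc : rel universe;
  indisc_equiv : equivalence_rel indisc;
  universe_nonempty : 0 < #|universe|
}.

Section RoughSets.
Variable I : approx_space.
Implicit Types (x y : I) (X Y Z C : {set I}).

Definition cls x : {set I} := [set y | indisc x y].
Definition classes : {set {set I}} := equivalence_partition (@indisc I) [set: I].

Definition lower X : {set I} := [set x | cls x \subset X].
Definition upper X : {set I} := [set x | cls x :&: X != set0].

(* T consists of the pairs RS(X): RS(X) = RS(Y) may hold with X != Y. *)
Record rough_set : Type := RoughSet {
  approx : {set I} * {set I};
  _ : approx \in [set (lower X, upper X) | X in [set: {set I}]]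
}.

HB.instance Definition _ := [isSub for approx].
HB.instance Definition _ := [Finite of rough_set by <:].

Lemma approx_inj : injective approx.
Proof. exact: val_inj. Qed.

Definition RS X : rough_set :=
  RoughSet (imset_f (fun X => (lower X, upper X)) (in_setT X)).

Definition IW X : nat := #|[set C in classes | C \subset X]|.

Definition new_classes X Y : {set {set I}} :=
  [set C in classes | [&& C \subset X :|: Y, ~~ (C \subset X) & ~~ (C \subset Y)]].

(* One round of the loop defining the Praba join. It leaves Y unchanged once
   the two counts agree. The natural subtraction is not truncated, since
   IW (X :&: Y) <= IW X. *)
Definition trim X Y : {set I} :=
  if IW X + IW Y - IW (X :&: Y) < IW (X :|: Y) then
    if [pick C in new_classes X Y] is Some C then Y :\: C else Y
  else Y.

(* #|I| rounds always suffice: see praba_join_stops. *)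
Definition praba_join X Y : {set I} := X :|: iter #|I| (trim X) Y.

Definition pivots X Y : {set I} :=
  [set x | [&& ~~ (cls x \subset X :&: Y), cls x :&: X != set0
             & cls x :&: Y != set0]].

(* Exactly one pivot element is kept from each class of pivot elements. *)
Definition pivot_set X Y : {set I} :=
  transversal (equivalence_partition (@indisc I) (pivots X Y)) (pivots X Y).

Definition praba_meet X Y : {set I} :=
  [set x | cls x \subset X :&: Y] :|: pivot_set X Y.

Lemma RS_surj (a : rough_set) : exists X, RS X == a.
Proof.
case: a => p Hp; have /imsetP[X _ eX] := Hp.
by exists X; apply/eqP/val_inj.
Qed.

Definition rset_repr (a : rough_set) : {set I} := xchoose (RS_surj a).

Lemma indisc_refl x : indisc x x.
Proof. by have [] := indisc_equiv x x x. Qed.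

Lemma indiscL x y : indisc x y -> indisc x =1 indisc y.
Proof. by move=> h z; have [_ ->] := indisc_equiv x y z. Qed.

Lemma mem_cls x : x \in cls x.
Proof. by rewrite inE indisc_refl. Qed.

Lemma clsE x y : y \in cls x -> cls y = cls x.
Proof. by rewrite inE => h; apply/setP => z; rewrite !inE (indiscL h). Qed.

Lemma clsP C : reflect (exists x, C = cls x) (C \in classes).
Proof.
apply: (iffP imsetP) => [[x _ ->]|[x ->]]; exists x; rewrite ?inE //.
  by apply/setP => z; rewrite !inE.
by apply/setP => z; rewrite !inE.
Qed.

Lemma cls_eq x y z : z \in cls x -> z \in cls y -> cls x = cls y.
Proof. by move=> /clsE <- /clsE <-. Qed.

Lemma lowerP X x : (x \in lower X) = (cls x \subset X).
Proof. by rewrite inE. Qed.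

Lemma upperP X x : reflect (exists2 y, y \in cls x & y \in X) (x \in upper X).
Proof.
rewrite inE; apply: (iffP (set0Pn _)) => [[y /setIP[]]|[y h1 h2]]; exists y => //.
exact/setIP.
Qed.

Lemma upperU X Y : upper (X :|: Y) = upper X :|: upper Y.
Proof.
apply/setP => x; rewrite in_setU; apply/upperP/orP.
  by case=> y yx /setUP[h|h]; [left|right]; apply/upperP; exists y.
by case=> /upperP[y yx h]; exists y => //; rewrite inE h ?orbT.
Qed.

Lemma lower_sub_upper X : lower X \subset upper X.
Proof.
apply/subsetP => x; rewrite lowerP => /subsetP h.
by apply/upperP; exists x; [|apply: h]; apply: mem_cls.
Qed.

Lemma IW_setU X Y :
  IW (X :|: Y) = IW X + IW Y - IW (X :&: Y) + #|new_classes X Y|.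
Proof.
have e : [set C in classes | C \subset X :|: Y] =
  ([set C in classes | C \subset X] :|: [set C in classes | C \subset Y])
    :|: new_classes X Y.
  apply/setP => C; rewrite !inE; case: (C \in classes) => //=.
  case hX: (C \subset X) => /=; first by rewrite (subset_trans hX) ?subsetUl.
  case hY: (C \subset Y) => /=; first by rewrite (subset_trans hY) ?subsetUr.
  by rewrite andbT.
rewrite {1}/IW e [LHS]cardsU [X in _ - X](_ : _ = 0) ?subn0; last first.
  apply/eqP; rewrite cards_eq0; apply/eqP/setP => C; rewrite !inE.
  by case: (C \in classes) => //=; case: (C \subset X) => //=;
     case: (C \subset Y) => //=; rewrite ?andbF.
congr (_ + _); rewrite cardsU; congr (_ - #|pred_of_set _|).
by apply/setP => C; rewrite !inE subsetI; case: (C \in classes).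
Qed.

Lemma new_classesD X Y C :
  C \in new_classes X Y -> new_classes X (Y :\: C) = new_classes X Y :\ C.
Proof.
rewrite inE => /andP[/clsP[x ->] /and3P[hU hX hY]].
apply/setP => D; rewrite in_setD1 !inE.
case: clsP => //=; last by rewrite andbF.
case=> y ->; case: eqVneq => [->|ne] /=.
  rewrite hX; apply/negbTE/negP => /and3P[/subsetP h _ _].
  by case/subsetPn: hX => z zx /negP[]; move: (h z zx); rewrite inE inE zx orbF.
have dis z : z \in cls y -> z \notin cls x.
  by move=> h; apply: contra ne => /(cls_eq h) ->.
congr [&& _, _ & ~~ _]; apply/subsetP/subsetP => h z zy;
  by move: (h z zy); rewrite !inE -?[indisc x z](inE _ z);
     have:= dis _ zy; rewrite inE => /negbTE ->.
Qed.

Lemma card_new_classes X Y : #|new_classes X Y| <= #|I|.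
Proof.
rewrite -cardsT (leq_trans _ (leq_imset_card cls [set: I])) //.
apply/subset_leq_card/subsetP => C; rewrite inE => /andP[/clsP[x ->] _].
by apply/imsetP; exists x.
Qed.

Lemma new_classes_trim X Y :
  #|new_classes X (trim X Y)| = #|new_classes X Y|.-1.
Proof.
rewrite /trim IW_setU -[X in X < _]addn0 ltn_add2l.
case: ltnP => [gt0|]; last by rewrite leqn0 => /eqP ->.
case: pickP => [C hC|h]; first by rewrite new_classesD // [in RHS](cardsD1 C) hC.
by rewrite (eq_card0 h) in gt0.
Qed.

Lemma new_classes_final X Y : new_classes X (iter #|I| (trim X) Y) = set0.
Proof.
apply/eqP; rewrite -cards_eq0; have := card_new_classes X Y.
move: #|I| Y => n; elim: n => [|n IHn] Z; first by rewrite leqn0.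
by move=> h; rewrite iterSr; apply: IHn; rewrite new_classes_trim; case: #|_| h.
Qed.

Lemma praba_join_stops X Y (Y' := iter #|I| (trim X) Y) :
  IW (X :|: Y') = IW X + IW Y' - IW (X :&: Y').
Proof. by rewrite IW_setU new_classes_final cards0 addn0. Qed.

Lemma lower_trim X Y : lower (trim X Y) = lower Y.
Proof.
rewrite /trim; case: ifP => // _; case: pickP => // C; rewrite inE.
case/andP=> /clsP[x ->] /and3P[_ _ hY].
apply/setP => y; rewrite !lowerP subsetD; case hy: (cls y \subset Y) => //=.
apply/pred0P => z /=; apply/negbTE/negP => /andP[zy zx].
by move: hY; rewrite -(cls_eq zy zx) hy.
Qed.

Lemma upper_trim X Y : upper (X :|: trim X Y) = upper (X :|: Y).
Proof.
rewrite /trim; case: ifP => // _; case: pickP => // C; rewrite inE.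
case/andP=> /clsP[x ->] /and3P[/subsetP hU _ /subsetPn[z zx zY]].
have zX : z \in X by move: (hU z zx); rewrite inE (negbTE zY) orbF.
apply/setP => y; apply/upperP/upperP => -[t ty].
  by rewrite !inE => h; exists t => //; case/orP: h => [|/andP[_]]; rewrite inE => ->; rewrite ?orbT.
case: (boolP (t \in cls x)) => [tx _|ntx].
  by exists z; rewrite ?inE ?zX //; move: zx; rewrite -(cls_eq ty tx) inE.
by move=> /setUP h; exists t => //; apply/setUP; case: h; [left|right; apply/setDP].
Qed.

Lemma lower_praba_join X Y : lower (praba_join X Y) = lower X :|: lower Y.
Proof.
have -> : lower Y = lower (iter #|I| (trim X) Y).
  by elim: #|I| => //= n ->; rewrite lower_trim.
rewrite /praba_join; have := new_classes_final X Y.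
move: (iter _ _ _) => {}Y /setP h; apply/setP => x; rewrite in_setU !lowerP.
have := h (cls x); rewrite !inE (introT (clsP _)) /=; last by exists x.
case hX: (cls x \subset X) => /=; first by rewrite (subset_trans hX) ?subsetUl.
case hY: (cls x \subset Y) => /=; first by rewrite (subset_trans hY) ?subsetUr.
by rewrite andbT.
Qed.

Lemma upper_praba_join X Y : upper (praba_join X Y) = upper X :|: upper Y.
Proof.
by rewrite /praba_join -upperU; elim: #|I| => //= n <-; rewrite upper_trim.
Qed.

Lemma pivots_equiv X Y : {in pivots X Y & &, equivalence_rel (@indisc I)}.
Proof. by move=> x y z _ _ _; apply: indisc_equiv. Qed.

Lemma pivot_trans X Y :
  is_transversal (pivot_set X Y)
    (equivalence_partition (@indisc I) (pivots X Y)) (pivots X Y).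
Proof. exact/transversalP/equivalence_partitionP/pivots_equiv. Qed.

Lemma pivot_set_sub X Y : pivot_set X Y \subset pivots X Y.
Proof. exact: transversal_sub (pivot_trans X Y). Qed.

Lemma cls_pivots X Y x y : y \in cls x -> (y \in pivots X Y) = (x \in pivots X Y).
Proof. by move=> h; rewrite !inE (clsE h). Qed.

Lemma cls_block X Y x :
  x \in pivots X Y -> cls x \in equivalence_partition (@indisc I) (pivots X Y).
Proof.
move=> xP; apply/imsetP; exists x => //; apply/setP => z.
rewrite !inE; case h: (indisc x z); last by rewrite andbF.
by move: xP; rewrite -(@cls_pivots X Y x z) ?inE // andbT => ->.
Qed.

Lemma pivot_setI X Y x :
  x \in pivots X Y -> exists y, pivot_set X Y :&: cls x = [set y].
Proof.
move=> /cls_block/(setI_transversal_pblock (pivot_trans X Y) x) ->.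
by eexists.
Qed.

(* A class containing a pivot element has at least two elements, so it is not
   contained in the pivot set. *)
Lemma lower_praba_meet X Y : lower (praba_meet X Y) = lower X :&: lower Y.
Proof.
apply/setP => x; rewrite in_setI !lowerP -subsetI.
apply/subsetP/idP => [h|h y yx]; last by rewrite !inE (clsE yx) h.
case hx: (cls x \subset X :&: Y) => //.
have hp z : z \in cls x -> z \in pivot_set X Y.
  by move=> zx; have := h z zx; rewrite in_setU inE (clsE zx) hx.
have := hp x (mem_cls x) => /(subsetP (pivot_set_sub X Y)) xP.
have [t et] := pivot_setI xP; move: (xP); rewrite inE => /and3P[_].
have ct : cls x = [set t].
  by rewrite -et; apply/esym/setIidPr/subsetP.
rewrite ct => /set0Pn[a /setIP[/set1P -> tX]] /set0Pn[b /setIP[/set1P -> tY]].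
by move: hx; rewrite ct sub1set inE tX tY.
Qed.

Lemma upper_praba_meet X Y : upper (praba_meet X Y) = upper X :&: upper Y.
Proof.
apply/setP => x; apply/upperP/setIP => [[y yx]|[xX xY]].
  case/setUP; last first.
    move=> /(subsetP (pivot_set_sub X Y)); rewrite (cls_pivots _ _ yx) !inE.
    by case/and3P.
  rewrite inE (clsE yx) subsetI => /andP[hX hY].
  by split; apply: (subsetP (lower_sub_upper _)); rewrite lowerP.
case hx: (cls x \subset X :&: Y).
  by exists x; rewrite ?mem_cls // !inE hx.
have xP : x \in pivots X Y by move: xX xY; rewrite !inE hx => -> ->.
have [t et] := pivot_setI xP; have := set11 t; rewrite -et => /setIP[tP tx].
by exists t => //; rewrite inE tP orbT.
Qed.

End RoughSets.

(* RS_praba_join and RS_praba_meet show that these operations do not depend on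
   the chosen subsets of I. *)
HB.lock Definition rough_join (I : approx_space) (a b : rough_set I) :=
  RS (praba_join (rset_repr a) (rset_repr b)).
HB.lock Definition rough_meet (I : approx_space) (a b : rough_set I) :=
  RS (praba_meet (rset_repr a) (rset_repr b)).

Section RoughSemiring.
Variable I : approx_space.
Implicit Types (x y : I) (X Y Z C : {set I}) (a b c : rough_set I).

Definition rough_le a b : bool :=
  ((approx a).1 \subset (approx b).1) && ((approx a).2 \subset (approx b).2).

Lemma rset_reprK a : RS (rset_repr a) = a.
Proof. exact/eqP/(xchooseP (RS_surj a)). Qed.

Lemma rough_le_refl : reflexive rough_le.
Proof. by move=> a; rewrite /rough_le !subxx. Qed.

Lemma rough_le_anti : antisymmetric rough_le.
Proof.
move=> a b /andP[/andP[h1 h2] /andP[h3 h4]]; apply: approx_inj.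
move: h1 h2 h3 h4; case: (approx a) (approx b) => [a1 a2] [b1 b2] /= h1 h2 h3 h4.
by congr pair; apply/eqP; rewrite eqEsubset ?h1 ?h2 ?h3 ?h4.
Qed.

Lemma rough_le_trans : transitive rough_le.
Proof.
move=> b a c /andP[h1 h2] /andP[h3 h4].
by rewrite /rough_le (subset_trans h1) ?(subset_trans h2).
Qed.

Lemma RS_inj2 X Y : lower X = lower Y -> upper X = upper Y -> RS X = RS Y.
Proof. by move=> h1 h2; apply: val_inj; rewrite /= h1 h2. Qed.

Lemma RS_repr X :
  lower (rset_repr (RS X)) = lower X /\ upper (rset_repr (RS X)) = upper X.
Proof. by case: (congr1 (@approx I) (rset_reprK (RS X))). Qed.

Lemma RS_praba_join X Y : rough_join (RS X) (RS Y) = RS (praba_join X Y).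
Proof.
rewrite unlock; have [] := RS_repr X; have [] := RS_repr Y.
move: (rset_repr (RS X)) (rset_repr (RS Y)) => X' Y' lY uY lX uX.
by apply: RS_inj2; rewrite !(lower_praba_join, upper_praba_join) ?lX ?uX ?lY ?uY.
Qed.

Lemma RS_praba_meet X Y : rough_meet (RS X) (RS Y) = RS (praba_meet X Y).
Proof.
rewrite unlock; have [] := RS_repr X; have [] := RS_repr Y.
move: (rset_repr (RS X)) (rset_repr (RS Y)) => X' Y' lY uY lX uX.
by apply: RS_inj2; rewrite !(lower_praba_meet, upper_praba_meet) ?lX ?uX ?lY ?uY.
Qed.

Lemma approx_RS_repr a : approx a = (lower (rset_repr a), upper (rset_repr a)).
Proof. by rewrite -{1}(rset_reprK a). Qed.

Lemma approx_rough_join a b :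
  approx (rough_join a b) =
  ((approx a).1 :|: (approx b).1, (approx a).2 :|: (approx b).2).
Proof.
by rewrite unlock /RS [LHS]/= lower_praba_join upper_praba_join !approx_RS_repr.
Qed.

Lemma approx_rough_meet a b :
  approx (rough_meet a b) =
  ((approx a).1 :&: (approx b).1, (approx a).2 :&: (approx b).2).
Proof.
by rewrite unlock /RS [LHS]/= lower_praba_meet upper_praba_meet !approx_RS_repr.
Qed.

Lemma approx_RS0 : approx (RS (set0 : {set I})) = (set0, set0).
Proof.
congr pair; apply/setP => x; rewrite !inE ?setI0 ?eqxx // subset0.
by apply/negbTE/set0Pn; exists x; rewrite mem_cls.
Qed.

Lemma approx_RST : approx (RS [set: I]) = ([set: I], [set: I]).
Proof.
congr pair; apply/setP => x; rewrite !inE ?subsetT // setIT.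
by apply/set0Pn; exists x; rewrite mem_cls.
Qed.

Lemma rough_joinA : associative (@rough_join I).
Proof.
by move=> a b c; apply: approx_inj; rewrite !approx_rough_join /= !setUA.
Qed.

Lemma rough_joinC : commutative (@rough_join I).
Proof.
move=> a b; apply: approx_inj; rewrite !approx_rough_join.
by congr pair; rewrite setUC.
Qed.

Lemma rough_join0 : left_id (RS set0) (@rough_join I).
Proof.
move=> a; apply: approx_inj; rewrite approx_rough_join approx_RS0 /= !set0U.
by case: (approx a).
Qed.

Lemma rough_meetA : associative (@rough_meet I).
Proof.
by move=> a b c; apply: approx_inj; rewrite !approx_rough_meet /= !setIA.
Qed.

Lemma rough_meetC : commutative (@rough_meet I).
Proof.
move=> a b; apply: approx_inj; rewrite !approx_rough_meet.
by congr pair; rewrite setIC.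
Qed.

Lemma rough_meet1 : left_id (RS [set: I]) (@rough_meet I).
Proof.
move=> a; apply: approx_inj; rewrite approx_rough_meet approx_RST /= !setTI.
by case: (approx a).
Qed.

Lemma rough_meetDl : left_distributive (@rough_meet I) (@rough_join I).
Proof.
move=> a b c; apply: approx_inj.
by rewrite !(approx_rough_join, approx_rough_meet) /= !setIUl.
Qed.

Lemma rough_meet0 : left_zero (RS set0) (@rough_meet I).
Proof.
by move=> a; apply: approx_inj; rewrite approx_rough_meet approx_RS0 /= !set0I.
Qed.

Lemma RST_neq0 : RS [set: I] != RS (set0 : {set I}).
Proof.
apply/eqP => /(congr1 (@approx I)); rewrite approx_RST approx_RS0 => -[/setP h].
by have /card_gt0P[x _] := universe_nonempty I; have := h x; rewrite !inE.
Qed.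

End RoughSemiring.

Fact rough_display : Order.disp_t. Proof. exact: Order.Disp tt tt. Qed.

HB.instance Definition _ I :=
  Order.Le_isPOrder.Build rough_display (rough_set I)
    (@rough_le_refl I) (@rough_le_anti I) (@rough_le_trans I).

(* The rough semiring: + is the Praba join on T and * is the Praba meet. *)
HB.instance Definition _ I := GRing.isNmodule.Build (rough_set I)
  (@rough_joinA I) (@rough_joinC I) (@rough_join0 I).

HB.instance Definition _ I := GRing.Nmodule_isComNzSemiRing.Build (rough_set I)
  (@rough_meetA I) (@rough_meetC I) (@rough_meet1 I) (@rough_meetDl I)
  (@rough_meet0 I) (@RST_neq0 I).

Definition is_pseudocomplement (I : approx_space) (a p : rough_set I) : Prop :=
  (a * p = RS set0)%R /\
  forall b : rough_set I, (a * b = RS set0)%R -> (b <= p)%O.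

(* Main.v *)
(* The complement of the upper approximation of X is a union of classes, hence
   exact, and a rough set is disjoint from RS X exactly when its upper
   approximation lies in that complement. So RS (~: upper X) is the
   pseudocomplement; uniqueness is antisymmetry of the order. *)
Require Import Defs.
From mathcomp Require Import all_boot all_order all_algebra.

Lemma mem_upper_cls (I : approx_space) (X : {set I}) (x y : I) :
  y \in cls x -> (y \in upper X) = (x \in upper X).
Proof. by move=> yx; rewrite !inE (clsE yx). Qed.

(** Membership in [upper X] is constant on each class, so its complement is a union of classes. *)
Lemma lower_setC_upper (I : approx_space) (X : {set I}) :
  lower (~: upper X) = ~: upper X.
Proof.
apply/setP => x; rewrite lowerP; apply/subsetP/idP => [|xX y yx].
  by apply; apply: mem_cls.
by rewrite in_setC (mem_upper_cls _ _ _ _ yx) -in_setC.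
Qed.

Lemma upper_setC_upper (I : approx_space) (X : {set I}) :
  upper (~: upper X) = ~: upper X.
Proof.
(* The reverse inclusion holds because the set is its own lower approximation. *)
apply/eqP; rewrite eqEsubset -{3}lower_setC_upper lower_sub_upper andbT.
apply/subsetP => x /upperP[y yx].
by rewrite !in_setC (mem_upper_cls _ _ _ _ yx).
Qed.

(** Since [lower] lies inside [upper], disjoint upper parts force disjoint lower parts. *)
Lemma rough_mul_eq0 (I : approx_space) (X Y : {set I}) :
  (RS X * RS Y = RS set0)%R <-> upper Y \subset ~: upper X.
Proof.
have approxM : approx (RS X * RS Y)%R =
    (lower X :&: lower Y, upper X :&: upper Y) := approx_rough_meet _ _.
rewrite -disjoints_subset disjoint_sym -setI_eq0; split=> [XY0 | /eqP uXY0].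
  by move: approxM; rewrite XY0 approx_RS0 => -[_ <-].
apply: approx_inj; rewrite approxM approx_RS0 uXY0; congr pair.
by apply/eqP; rewrite -subset0 -uXY0 setISS ?lower_sub_upper.
Qed.

Lemma RS_setC_upper_pseudocomplement (I : approx_space) (X : {set I}) :
  is_pseudocomplement (RS X) (RS (~: upper X)).
Proof.
split=> [|b]; first by apply/rough_mul_eq0; rewrite upper_setC_upper.
rewrite -(rset_reprK b) => /rough_mul_eq0 uY.
rewrite [(_ <= _)%O]/(rough_le _ _) /rough_le /= lower_setC_upper.
by rewrite upper_setC_upper uY (subset_trans (lower_sub_upper _) uY).
Qed.

Theorem theorem3 (I : approx_space) (X : {set I}) :
  exists! p : rough_set I, is_pseudocomplement (RS X) p.
Proof.
exists (RS (~: upper X)); split=> [|q [q0 q_max]].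
  exact: RS_setC_upper_pseudocomplement.
have [p0 p_max] := RS_setC_upper_pseudocomplement I X.
(* Each candidate is disjoint from [RS X], hence below the other. *)
by apply: Order.POrderTheory.le_anti; rewrite q_max ?p_max.
Qed.
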